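(* $\mathcal{MR}\!\left(\frac{I_{12}}{12},\frac{I_{12}}{12}\right)=16=\lfloor\sqrt{12^2+12^2-1}\rfloor$.
   Context: $\mathbb{M}_n$ is the algebra of complex $n\times n$ matrices with identity $I_n$. A linear map $\Phi:\mathbb{M}_{d_1}\to\mathbb{M}_{d_2}$ is completely positive (CP) if and only if $\Phi(X)=\sum_{j=1}^r V_j^*XV_j$ for some complex $d_1\times d_2$ matrices $V_j$; the smallest possible $r$ is the Choi-rank $CR(\Phi)$. $\Phi^*:\mathbb{M}_{d_2}\to\mathbb{M}_{d_1}$ is the dual map defined by $\mathrm{tr}(\Phi(X)^*Y)=\mathrm{tr}(X^*\Phi^*(Y))$. For $A_1\in\mathbb{M}_{d_1}$, $A_2\in\mathbb{M}_{d_2}$, let $\mathcal{CP}[\mathbb{M}_{d_1},\mathbb{M}_{d_2};A_1,A_2]$ be the convex set of all CP maps $\Phi:\mathbb{M}_{d_1}\to\mathbb{M}_{d_2}$ with $\Phi(I_{d_1})=A_2$ and $\Phi^*(I_{d_2})=A_1$, and let $\mathcal{MR}(A_1,A_2)=\sup\{CR(\Phi):\Phi\text{ is an extreme point of }\mathcal{CP}[\mathbb{M}_{d_1},\mathbb{M}_{d_2};A_1,A_2]\}$. $\lfloor a\rfloor$ is the largest integer not exceeding $a$. Here $d_1=d_2=12$. *)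

(* Defs.v *)
From HB Require Import structures.
From mathcomp Require Export all_boot all_order all_algebra.
From mathcomp Require Export all_classical all_reals ereal.
From mathcomp Require Export complex.

Set Implicit Arguments.
Unset Strict Implicit.
Unset Printing Implicit Defensive.

Import Order.TTheory GRing.Theory Num.Theory.
Local Open Scope ring_scope.
Local Open Scope classical_set_scope.
Local Open Scope complex_scope.
Local Open Scope sesquilinear_scope.

(* The space of linear maps M_d1 -> M_d2 is 'Hom('M[R[i]]_d1, 'M[R[i]]_d2),
   a vector space over R[i]; M ^t* is the conjugate transpose of M. *)

Section ExtremePoints.
Variables (R : realType) (E : lmodType R[i]).

Definition extreme_points (K : set E) : set E :=
  [set x | K x /\
    forall (y z : E) (t : R), K y -> K z -> 0 < t < 1 ->
      x = t%:C *: y + (1 - t)%:C *: z -> y = x /\ z = x].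

End ExtremePoints.

Section CompletelyPositiveMaps.
Variable R : realType.
Variables d1 d2 : nat.
Local Notation C := R[i].
Local Notation Hom := 'Hom('M[C]_d1, 'M[C]_d2).

Definition kraus_rep (Phi : Hom) (r : nat) : Prop :=
  exists V : 'I_r -> 'M[C]_(d1, d2),
    forall X : 'M[C]_d1, Phi X = \sum_(j < r) (V j)^t* *m X *m V j.

Definition completely_positive (Phi : Hom) : Prop :=
  exists r : nat, kraus_rep Phi r.

(* Meaningful for completely positive Phi only (see choi_rankP);
   otherwise the value is the junk value 0. *)
Definition choi_rank (Phi : Hom) : nat :=
  xget 0%N [set r | kraus_rep Phi r /\
                    forall s : nat, kraus_rep Phi s -> (r <= s)%N].

Definition is_dual_map (Phi : Hom) (Psi : 'Hom('M[C]_d2, 'M[C]_d1)) : Prop :=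
  forall (X : 'M[C]_d1) (Y : 'M[C]_d2),
    \tr ((Phi X)^t* *m Y) = \tr (X^t* *m Psi Y).

(* The unique linear map satisfying is_dual_map Phi: see dual_mapP and
   dual_map_unique. *)
Definition dual_map (Phi : Hom) : 'Hom('M[C]_d2, 'M[C]_d1) :=
  xget 0 [set Psi | is_dual_map Phi Psi].

Definition CP_set (A1 : 'M[C]_d1) (A2 : 'M[C]_d2) : set Hom :=
  [set Phi | [/\ completely_positive Phi,
                 Phi 1%:M = A2 &
                 dual_map Phi 1%:M = A1]].

(* The supremum is taken in the extended reals, so it is a genuine supremum
   even for an empty or unbounded set. *)
Definition MR (A1 : 'M[C]_d1) (A2 : 'M[C]_d2) : \bar R :=
  ereal_sup [set ((choi_rank Phi)%:R : R)%:E |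
             Phi in extreme_points (CP_set A1 A2)].

Lemma choi_rankP (Phi : Hom) : completely_positive Phi ->
  kraus_rep Phi (choi_rank Phi) /\
  forall s : nat, kraus_rep Phi s -> (choi_rank Phi <= s)%N.
Proof.
move=> [r0 kr0]; rewrite /choi_rank; case: xgetP => [r _ //|none].
have ex : exists r, `[< kraus_rep Phi r >] by exists r0; apply/asboolP.
case: (ex_minnP ex) => m /asboolP km mmin; case: (none m); split=> // s ks.
by apply: mmin; apply/asboolP.
Qed.

Lemma tr_adj_delta n (Z : 'M[C]_n) (i j : 'I_n) :
  \tr ((delta_mx i j)^t* *m Z) = Z i j.
Proof.
rewrite /mxtrace (bigD1 j) //= [X in _ + X]big1 ?addr0 => [|k kj].
  rewrite mxE (bigD1 i) //= big1 ?addr0 => [|l li].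
    by rewrite !mxE !eqxx conjC1 mul1r.
  by rewrite !mxE (negbTE li) conjC0 mul0r.
by rewrite mxE big1 // => l _; rewrite !mxE (negbTE kj) andbF conjC0 mul0r.
Qed.

Lemma dual_map_unique (Phi : Hom) (Psi1 Psi2 : 'Hom('M[C]_d2, 'M[C]_d1)) :
  is_dual_map Phi Psi1 -> is_dual_map Phi Psi2 -> Psi1 = Psi2.
Proof.
move=> h1 h2; apply/lfunP => Y; apply/matrixP => i j.
by rewrite -[LHS]tr_adj_delta -[RHS]tr_adj_delta -h1 -h2.
Qed.

Lemma dual_mapP (Phi : Hom) : is_dual_map Phi (dual_map Phi).
Proof.
rewrite /dual_map; case: xgetP => [//|none].
pose f (Y : 'M[C]_d2) : 'M[C]_d1 :=
  \matrix_(i, j) \tr ((Phi (delta_mx i j))^t* *m Y).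
have f_lin : linear f.
  move=> a Y Z; apply/matrixP => i j.
  by rewrite !mxE mulmxDr -scalemxAr linearD linearZ.
pose fL := GRing.isLinear.Build _ _ _ _ f f_lin.
pose F : {linear 'M[C]_d2 -> 'M[C]_d1} := HB.pack f fL.
case: (none (linfun F)) => X Y; rewrite lfunE /=.
have adjD (m : nat) (A B : 'M[C]_m) : (A + B)^t* = A^t* + B^t*.
  by rewrite linearD /= map_mxD.
have adjZ (m : nat) a (A : 'M[C]_m) : (a *: A)^t* = a^* *: A^t*.
  by rewrite linearZ /= map_mxZ.
have adj0 (m : nat) : (0 : 'M[C]_m)^t* = 0 by rewrite trmx0 map_mx0.
have adj_sum (m : nat) I (s : seq I) (G : I -> 'M[C]_m) :
    (\sum_(i <- s) G i)^t* = \sum_(i <- s) (G i)^t*.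
  by elim/big_rec2: _ => [//|i A B _ <-]; rewrite adjD.
have eX := matrix_sum_delta X; rewrite {1}eX [in RHS]eX {eX}.
rewrite linear_sum !adj_sum !mulmx_suml !linear_sum /=; apply: eq_bigr => i _.
rewrite linear_sum !adj_sum !mulmx_suml !linear_sum /=; apply: eq_bigr => j _.
rewrite linearZ /= !adjZ -!scalemxAl !linearZ /=; congr (_ * _).
by rewrite tr_adj_delta mxE.
Qed.

End CompletelyPositiveMaps.

(* Main.v *)
(* For CP maps with Kraus operators V_1, ..., V_r everything is governed by the
   r^2 matrices V_i^* V_j (+) V_j V_i^*, which lie in the space of pairs of equal
   trace, of dimension d1^2 + d2^2 - 1.

   If they are independent then Phi is extreme with Choi-rank r: the Kraus
   operators of any convex summand of Phi lie in the span of the V_j, so the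
   summand is X |-> sum c_ij V_i^* X V_j, and its values and those of its dual at
   the identity force c = 1.  Conversely a minimal Kraus family with r^2 >=
   d1^2 + d2^2 has a nonzero Hermitian relation; after diagonalising it by a
   unitary change of Kraus operators, with eigenvalues scaled to lie in [-1, 1]
   and one of them equal to 1, the maps with weights 1 + s_a and 1 - s_a show
   that Phi is not extreme, since the second one has r - 1 Kraus operators.

   Hence the bound 16 for d1 = d2 = 12.  It is attained by 16 partial permutation
   matrices of rank 3 with disjoint supports, four cells in each row and column:
   these are so placed that two rounds through the off-diagonal entries of a
   relation, each time solving those with a single unknown coefficient left,
   determine all c_ij with i <> j, and the diagonal entries form a 24 x 16
   system of full rank for the c_ii. *)
From HB Require Import structures.
Require Import Defs.
From mathcomp Require Import all_boot all_order all_algebra.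
From mathcomp Require Import all_classical all_reals ereal.
From mathcomp Require Import complex ring.

Set Implicit Arguments.
Unset Strict Implicit.
Unset Printing Implicit Defensive.

Import Order.TTheory GRing.Theory Num.Theory.

Local Open Scope ring_scope.
Local Open Scope sesquilinear_scope.

(** * Sesquilinear combinations of Kraus operators *)

Lemma mxvec_mulmx (K : comNzRingType) m n (A : 'M[K]_(m, n)) (v : 'cV_(m * n)) :
  (mxvec A *m v) 0 0 = \sum_i \sum_j A i j * v (mxvec_index i j) 0.
Proof.
rewrite mxE (reindex _ (curry_mxvec_bij _ _)) pair_bigA.
by apply: eq_bigr => -[i j] _ /=; rewrite mxvecE.
Qed.

Section Sandwiches.
Variable C : numClosedFieldType.

Lemma trmxC_mul m n p (A : 'M[C]_(m, n)) (B : 'M[C]_(n, p)) :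
  (A *m B)^t* = B^t* *m A^t*.
Proof. by rewrite trmx_mul map_mxM. Qed.

Lemma trmxCD m n (A B : 'M[C]_(m, n)) : (A + B)^t* = A^t* + B^t*.
Proof. by rewrite linearD map_mxD. Qed.

Lemma trmxCZ m n a (A : 'M[C]_(m, n)) : (a *: A)^t* = a^* *: A^t*.
Proof. by rewrite linearZ /= map_mxZ. Qed.

(** A common interface for [sandwich] and [dual_sandwich], so that each computation below serves
    both a map and its dual. *)
Definition sesquilinear_map (U L : lmodType C) (f : U -> U -> L) :=
  (forall a u v w, f (a *: u + v) w = a^* *: f u w + f v w) /\
  (forall a u v w, f w (a *: u + v) = a *: f w u + f w v).

Section Sesquilinear.
Variables (U L : lmodType C) (f : U -> U -> L).
Hypothesis fP : sesquilinear_map f.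

Lemma sesquilinear0l w : f 0 w = 0.
Proof.
have := fP.1 1 0 0 w; rewrite !scaler0 addr0 conjC1 scale1r.
by move=> /(congr1 (+%R^~ (- f 0 w))); rewrite addrK subrr.
Qed.

Lemma sesquilinear0r w : f w 0 = 0.
Proof.
have := fP.2 1 0 0 w; rewrite !scaler0 addr0 scale1r.
by move=> /(congr1 (+%R^~ (- f w 0))); rewrite addrK subrr.
Qed.

Lemma sesquilinearZ a b u v : f (a *: u) (b *: v) = (a^* * b) *: f u v.
Proof.
rewrite -[a *: u]addr0 fP.1 sesquilinear0l addr0 -[b *: v]addr0 fP.2.
by rewrite sesquilinear0r addr0 scalerA.
Qed.

Lemma sesquilinear_sqrtC a u : 0 <= a -> f (sqrtC a *: u) (sqrtC a *: u) = a *: f u u.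
Proof.
move=> a_ge0; rewrite sesquilinearZ conj_Creal -?expr2 ?sqrtCK //.
by rewrite ger0_real // sqrtC_ge0.
Qed.

Lemma sesquilinear_sum r s (a : 'I_r -> C) (b : 'I_s -> C) V W :
  f (\sum_i a i *: V i) (\sum_j b j *: W j) =
  \sum_i \sum_j ((a i)^* * b j) *: f (V i) (W j).
Proof.
rewrite (big_morph (f^~ _) (_ : {morph f^~ _ : x y / x + y}) (sesquilinear0l _)).
  apply: eq_bigr => i _.
  rewrite (big_morph (f _) (_ : {morph f _ : x y / x + y}) (sesquilinear0r _)).
    by apply: eq_bigr => j _; rewrite sesquilinearZ.
  by move=> x y; have := fP.2 1 x y; rewrite scale1r => ->; rewrite scale1r.
by move=> x y; have := fP.1 1 x y; rewrite scale1r conjC1 => ->; rewrite scale1r.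
Qed.

Definition combination r (V : 'I_r -> U) (c : 'M[C]_r) : L :=
  \sum_i \sum_j c i j *: f (V i) (V j).

Lemma combinationD r (V : 'I_r -> U) a c d :
  combination V (a *: c + d) = a *: combination V c + combination V d.
Proof.
rewrite /combination scaler_sumr -big_split; apply: eq_bigr => i _.
rewrite scaler_sumr -big_split; apply: eq_bigr => j _.
by rewrite !mxE scalerDl scalerA.
Qed.

Lemma combination1 r (V : 'I_r -> U) : combination V 1%:M = \sum_i f (V i) (V i).
Proof.
apply: eq_bigr => i _; rewrite (bigD1 i) //= mxE eqxx scale1r big1 ?addr0 //.
by move=> j /negPf ji; rewrite mxE eq_sym ji scale0r.
Qed.

Lemma combinationZ r (V : 'I_r -> U) a c :
  combination (fun j => a *: V j) c = (a^* * a) *: combination V c.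
Proof.
rewrite /combination scaler_sumr; apply: eq_bigr => i _.
rewrite scaler_sumr; apply: eq_bigr => j _.
by rewrite sesquilinearZ !scalerA mulrC.
Qed.

(** Mixing the operators by [P] acts on coefficient matrices as the congruence P^* diag(d) P. Both
    the unitary diagonalisation of a relation and the expansion of one Kraus family in another,
    where [P] may be rectangular, rest on this. *)
Lemma combination_mix r s (V : 'I_r -> U) (P : 'M[C]_(s, r)) (d : 'rV[C]_s) :
  \sum_a d 0 a *: f (\sum_j P a j *: V j) (\sum_j P a j *: V j) =
  combination V (P^t* *m diag_mx d *m P).
Proof.
under eq_bigr => a _.
  rewrite sesquilinear_sum scaler_sumr.
  under eq_bigr => i _ do rewrite scaler_sumr.
  over.
rewrite exchange_big; apply: eq_bigr => i _.
rewrite exchange_big; apply: eq_bigr => j _.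
rewrite mxE scaler_suml; apply: eq_bigr => a _.
by rewrite mul_mx_diag !mxE scalerA mulrCA mulrA mulrAC.
Qed.

End Sesquilinear.

Variables d1 d2 : nat.
Implicit Types V W : 'M[C]_(d1, d2).

Definition sandwich (X : 'M[C]_d1) V W : 'M[C]_d2 := V^t* *m X *m W.
Definition dual_sandwich (Y : 'M[C]_d2) V W : 'M[C]_d1 := W *m Y *m V^t*.

Lemma sandwich_sesquilinear X : sesquilinear_map (sandwich X).
Proof.
split=> a U V W; rewrite /sandwich.
  by rewrite trmxCD trmxCZ !mulmxDl -!scalemxAl.
by rewrite !mulmxDr -!scalemxAr.
Qed.

Lemma dual_sandwich_sesquilinear Y : sesquilinear_map (dual_sandwich Y).
Proof.
split=> a U V W; rewrite /dual_sandwich.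
  by rewrite trmxCD trmxCZ !mulmxDr -!scalemxAr.
by rewrite !mulmxDl -!scalemxAl.
Qed.

Lemma sandwich_trmxC V W : (sandwich 1%:M V W)^t* = sandwich 1%:M W V.
Proof. by rewrite /sandwich !mulmx1 trmxC_mul trmxCK. Qed.

Lemma dual_sandwich_trmxC V W : (dual_sandwich 1%:M V W)^t* = dual_sandwich 1%:M W V.
Proof. by rewrite /dual_sandwich !mulmx1 trmxC_mul trmxCK. Qed.

Lemma mxtrace_sandwich V W :
  \tr (sandwich 1%:M V W) = \tr (dual_sandwich 1%:M V W).
Proof. by rewrite /sandwich /dual_sandwich !mulmx1 mxtrace_mulC. Qed.

Lemma mxtrace_combination r (V : 'I_r -> 'M[C]_(d1, d2)) c :
  \tr (combination (sandwich 1%:M) V c) =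
  \tr (combination (dual_sandwich 1%:M) V c).
Proof.
rewrite /combination !linear_sum; apply: eq_bigr => i _.
rewrite !linear_sum; apply: eq_bigr => j _ /=.
by rewrite !mxtraceZ mxtrace_sandwich.
Qed.

(* [c] is a linear relation between the matrices [V_i^* V_j (+) V_j V_i^*]. *)
Definition kraus_relation r (V : 'I_r -> 'M[C]_(d1, d2)) (c : 'M[C]_r) :=
  combination (sandwich 1%:M) V c = 0 /\
  combination (dual_sandwich 1%:M) V c = 0.

Definition kraus_independent r (V : 'I_r -> 'M[C]_(d1, d2)) :=
  forall c, kraus_relation V c -> c = 0.

Lemma kraus_independentZ r (V : 'I_r -> 'M[C]_(d1, d2)) a :
  a != 0 -> kraus_independent V -> kraus_independent (fun j => a *: V j).
Proof.
move=> a0 V_indep c [c1 c2]; apply: V_indep.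
have aa0 : a^* * a != 0 by rewrite mulf_neq0 // conjC_eq0.
split; apply: (scalerI aa0); rewrite scaler0 -combinationZ //.
  exact: sandwich_sesquilinear.
exact: dual_sandwich_sesquilinear.
Qed.

Lemma kraus_relationD r (V : 'I_r -> 'M[C]_(d1, d2)) a c d :
  kraus_relation V c -> kraus_relation V d -> kraus_relation V (a *: c + d).
Proof.
by move=> [c1 c2] [e1 e2]; split; rewrite combinationD ?c1 ?c2 ?e1 ?e2 scaler0 addr0.
Qed.

Lemma combination_trmxC n (f : 'M[C]_(d1, d2) -> 'M[C]_(d1, d2) -> 'M[C]_n) r
    (V : 'I_r -> 'M[C]_(d1, d2)) c :
  (forall A B, (f A B)^t* = f B A) ->
  combination f V (c^t*) = (combination f V c)^t*.
Proof.
move=> fC; rewrite /combination exchange_big.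
rewrite [RHS](_ : _ = \sum_i (\sum_j c i j *: f (V i) (V j))^t*); last first.
  by rewrite !raddf_sum.
apply: eq_bigr => i _; rewrite !raddf_sum; apply: eq_bigr => j _ /=.
by rewrite trmxCZ fC !mxE.
Qed.

Lemma kraus_relation_trmxC r (V : 'I_r -> 'M[C]_(d1, d2)) c :
  kraus_relation V c -> kraus_relation V (c^t*).
Proof.
case=> c1 c2; split; rewrite combination_trmxC ?c1 ?c2 ?trmx0 ?map_mx0 //.
  exact: sandwich_trmxC.
exact: dual_sandwich_trmxC.
Qed.

(* The common trace of the two components leaves [d1^2 + d2^2 - 1] dimensions. *)
Lemma kraus_relation_exists r (V : 'I_r -> 'M[C]_(d1, d2)) :
  (0 < d1)%N -> (d1 ^ 2 + d2 ^ 2 <= r ^ 2)%N ->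
  exists2 c : 'M[C]_r, kraus_relation V c & c != 0.
Proof.
move=> d1gt0 le_r.
pose f (u : 'rV[C]_(r * r)) : 'rV[C]_(d2 * d2 + d1 * d1) :=
  row_mx (mxvec (combination (sandwich 1%:M) V (vec_mx u)))
         (mxvec (combination (dual_sandwich 1%:M) V (vec_mx u))).
have f_lin : linear f.
  move=> a u v; rewrite /f !linearP /= !combinationD !linearP /=.
  by rewrite scale_row_mx add_row_mx.
pose fL := GRing.isLinear.Build _ _ _ _ f f_lin.
pose F : {linear 'rV[C]_(r * r) -> 'rV[C]_(d2 * d2 + d1 * d1)} := HB.pack f fL.
pose A := lin1_mx F.
(* [B] encodes the functional (M, N) |-> tr M - tr N. It kills the range of [f], which costs [A] one
   unit of rank. *)
pose B : 'cV[C]_(d2 * d2 + d1 * d1) :=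
  col_mx (mxvec (1%:M : 'M[C]_d2))^T (- (mxvec (1%:M : 'M[C]_d1))^T).
have mxvec_tr n (M : 'M[C]_n) : mxvec M *m (mxvec (1%:M : 'M[C]_n))^T = (\tr M)%:M.
  apply/rowP => x; rewrite ord1 mxvec_mulmx mxE mulr1n.
  apply: eq_bigr => i _; rewrite (bigD1 i) //= big1 ?addr0; last first.
    by move=> j /negPf ji; rewrite mxE mxvecE mxE eq_sym ji mulr0.
  by rewrite mxE mxvecE mxE eqxx mulr1.
have AB0 : A *m B = 0.
  apply/row_matrixP => i; rewrite row_mul rowE mul_rV_lin1 /= /f /B mul_row_col.
  rewrite mulmxN !mxvec_tr row0 -raddfB /=.
  by rewrite mxtrace_combination subrr raddf0.
have B0 : (0 < \rank B)%N.
  pose o := Ordinal d1gt0; rewrite lt0n mxrank_eq0.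
  apply/eqP => /colP/(_ (rshift _ (mxvec_index o o))).
  by rewrite col_mxEd !mxE mxvecE mxE eqxx => /eqP; rewrite oppr_eq0 oner_eq0.
have : kermx A != 0.
  rewrite -mxrank_eq0 mxrank_ker -lt0n subn_gt0.
  have := leq_trans (leq_add (leqnn (\rank A)) B0) (mulmx0_rank_max AB0).
  by rewrite addn1 => /leq_trans -> //; rewrite !mulnn addnC.
case/rowV0Pn => u /sub_kermxP; rewrite mul_rV_lin1 /= /f => fu u0.
exists (vec_mx u); last by rewrite vec_mx_eq0.
have /eqP := fu; rewrite row_mx_eq0 !mxvec_eq0 => /andP[/eqP f1 /eqP f2].
by split.
Qed.

(** Relations are closed under adjoints, so c + c^* serves; if it vanishes, c is skew-Hermitian and
    i c serves. *)
Lemma hermitian_relation_exists r (V : 'I_r -> 'M[C]_(d1, d2)) :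
  (0 < d1)%N -> (d1 ^ 2 + d2 ^ 2 <= r ^ 2)%N ->
  exists c : 'M[C]_r, [/\ kraus_relation V c, c != 0 & c^t* = c].
Proof.
move=> d1gt0 le_r; have [c cV c0] := kraus_relation_exists V d1gt0 le_r.
have cV' := kraus_relation_trmxC cV.
have [cN|cN] := eqVneq (c + c^t*) 0; last first.
  exists (c + c^t*); split=> //.
    by have := kraus_relationD 1 cV cV'; rewrite scale1r.
  by rewrite trmxCD trmxCK addrC.
have ct : c^t* = - c by apply/eqP; rewrite -addr_eq0 addrC cN.
exists ('i *: c); split.
- by rewrite -[_ *: _]addr0; apply: kraus_relationD => //;
    split; rewrite /combination !big1 // => i _; rewrite big1 // => j _;
    rewrite mxE scale0r.
- by rewrite scaler_eq0 negb_or neq0Ci.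
- by rewrite trmxCZ conjCi ct scaleNr scalerN opprK.
Qed.

End Sandwiches.

(** * Extreme points and Choi-rank *)

Section Kraus.
Variables (R : realType) (d1 d2 : nat).
Local Notation C := R[i].
Local Notation Hom := 'Hom('M[C]_d1, 'M[C]_d2).
Implicit Types Phi : Hom.

Definition kraus_family Phi r (V : 'I_r -> 'M[C]_(d1, d2)) :=
  forall X, Phi X = \sum_j sandwich X (V j) (V j).

Lemma kraus_map_exists r (V : 'I_r -> 'M[C]_(d1, d2)) :
  exists Phi, kraus_family Phi V.
Proof.
pose f X := \sum_j sandwich X (V j) (V j).
have f_lin : linear f.
  move=> a X Y; rewrite /f scaler_sumr -big_split; apply: eq_bigr => j _ /=.
  by rewrite /sandwich mulmxDr mulmxDl -scalemxAr -scalemxAl.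
pose fL := GRing.isLinear.Build _ _ _ _ f f_lin.
pose F : {linear 'M[C]_d1 -> 'M[C]_d2} := HB.pack f fL.
by exists (linfun F) => X; rewrite lfunE.
Qed.

Lemma dual_map_kraus Phi r (V : 'I_r -> 'M[C]_(d1, d2)) Y :
  kraus_family Phi V -> dual_map Phi Y = \sum_j dual_sandwich Y (V j) (V j).
Proof.
move=> PhiV; apply/matrixP => i j.
rewrite -[LHS]tr_adj_delta -[RHS]tr_adj_delta -(dual_mapP Phi) PhiV.
rewrite mulmx_sumr !raddf_sum mulmx_suml raddf_sum; apply: eq_bigr => k _ /=.
by rewrite /sandwich /dual_sandwich !trmxC_mul trmxCK -!mulmxA mxtrace_mulC -!mulmxA.
Qed.

Lemma kraus_drop Phi r (V : 'I_r -> 'M[C]_(d1, d2)) a :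
  kraus_family Phi V -> V a = 0 -> exists2 s, (s < r)%N & kraus_rep Phi s.
Proof.
case: r V a => [_ []//|r] V a PhiV Va0; exists r => //.
exists (fun j => V (lift a j)) => X; rewrite PhiV (bigD1_ord a) //= Va0.
by rewrite sesquilinear0l ?add0r //; exact: sandwich_sesquilinear.
Qed.

Lemma extreme_choi_rank A1 A2 Phi : (0 < d1)%N ->
  extreme_points (CP_set A1 A2) Phi -> (choi_rank Phi ^ 2 < d1 ^ 2 + d2 ^ 2)%N.
Proof.
move=> d1_gt0 [[cp Phi1 Phi1']]; have [[V PhiV]] := choi_rankP cp.
move: (choi_rank Phi) V PhiV => r V PhiV rmin ext.
rewrite ltnNge; apply/negP => le_r.
have [c [[cV1 cV2] c0 ct]] := hermitian_relation_exists V d1_gt0 le_r.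
have herm : c \is hermsymmx by apply/is_hermitianmxP; rewrite expr0 scale1r.
have /orthomx_spectralP := hermitian_normalmx herm.
have dreal := hermitian_spectral_diag_real herm.
have := spectral_unitarymx c.
move: (spectralmx c) (spectral_diag c) dreal => P d dreal Punit.
rewrite invmx_unitary // => cE.
have PP : P^t* *m P = 1%:M by rewrite -invmx_unitary // mulVmx // unitarymx_unit.
(* Rotating by the unitary [P] preserves the Kraus sums and makes the relation [c] diagonal with
   entries [d]. *)
pose W a := \sum_j P a j *: V j.
have W_sum L f : @sesquilinear_map C _ L f ->
    \sum_a f (W a) (W a) = \sum_j f (V j) (V j).
  move=> fP; have := combination_mix fP V P (const_mx 1).
  rewrite diag_const_mx mulmx1 PP combination1 // => <-.
  by apply: eq_bigr => a _; rewrite mxE scale1r.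
pose x a := complex.Re (d 0 a).
have xE a : (x a)%:C%C = d 0 a by apply: RRe_real; exact: (mxOverP dreal).
have [a1 xa1] : exists a, x a != 0.
  apply/existsP; apply: contraR c0 => /existsPn x0.
  rewrite cE (_ : d = 0) ?raddf0 ?mulmx0 ?mul0mx ?eqxx //.
  apply/rowP => a; rewrite mxE -xE; move/negbNE/eqP: (x0 a) => ->.
  by rewrite raddf0.
(* Scaling by the eigenvalue of largest modulus keeps both weights [1 + s a] and
   [1 - s a] nonnegative and makes [1 - s a0] vanish. *)
pose a0 := [arg max_(a > a1) `|x a|]%O.
have xmax a : `|x a| <= `|x a0|.
  by rewrite /a0; case: arg_maxP => // b _; apply.
have xa0 : x a0 != 0.
  by rewrite -normr_gt0 (lt_le_trans _ (xmax a1)) // normr_gt0.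
pose s a := x a / x a0.
have s1 a : `|s a| <= 1 by rewrite normf_div ler_pdivrMr ?normr_gt0 // mul1r.
pose w (e : R) a : C := (1 + e * s a)%:C%C.
have w_ge0 e a : `|e| = 1 -> 0 <= w e a.
  move=> e1; rewrite ler0c -lerBlDl sub0r lerNl.
  by apply: le_trans (ler_norm _) _; rewrite normrN normrM e1 mul1r.
pose W' e a := sqrtC (w e a) *: W a.
have W'_sum (L : lmodType C) f e : @sesquilinear_map C _ L f -> `|e| = 1 ->
    \sum_a f (W' e a) (W' e a) = \sum_a w e a *: f (W a) (W a).
  move=> fP e1; apply: eq_bigr => a _.
  by rewrite sesquilinear_sqrtC // w_ge0.
(* The weights differ from 1 by a multiple of the eigenvalues [d], so the sum changes by a multiple
   of [combination f V c], which is zero. *)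
have W'_rel (L : lmodType C) f e : @sesquilinear_map C _ L f ->
    combination f V c = 0 -> `|e| = 1 ->
    \sum_a f (W' e a) (W' e a) = \sum_j f (V j) (V j).
  move=> fP fc e1; rewrite W'_sum // -W_sum //.
  under eq_bigr => a _.
    rewrite (_ : w e a = 1 + (e / x a0)%:C%C * d 0 a); last first.
      by rewrite -xE -rmorphM /w rmorphD rmorph1 /s mulrA mulrAC.
    rewrite scalerDl scale1r -scalerA.
    over.
  by rewrite big_split /= -scaler_sumr (combination_mix fP) -cE fc scaler0 addr0.
have Psi_exists e : `|e| = 1 ->
    exists2 Psi : Hom, kraus_family Psi (W' e) & CP_set A1 A2 Psi.
  move=> e1; have [Psi PsiW] := kraus_map_exists (W' e).
  exists Psi; [exact: PsiW|split; first by exists r, (W' e); exact: PsiW].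
    rewrite PsiW (W'_rel _ (sandwich 1%:M)) -?PhiV //.
    exact: sandwich_sesquilinear.
  rewrite (dual_map_kraus _ PsiW) (W'_rel _ (dual_sandwich 1%:M)) //.
    by rewrite -(dual_map_kraus _ PhiV).
  exact: dual_sandwich_sesquilinear.
have [Psi PsiW PsiCP] := Psi_exists 1 (normr1 _).
have [Psi' PsiW' PsiCP'] := Psi_exists (-1) (normrN1 _).
have half : 0 < (2^-1 : R) < 1.
  by rewrite invr_gt0 ltr0n invf_lt1 ?ltr0n // ltr1n.
have average u : 2^-1 * (1 + 1 * u) + (1 - 2^-1) * (1 + -1 * u) = 1 :> R by field.
have [] := ext _ _ _ PsiCP PsiCP' half.
  apply/lfunP => X; rewrite !lfunE /= !lfunE /= PsiW PsiW' PhiV.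
  have fP := sandwich_sesquilinear (d1 := d1) d2 X.
  rewrite !(W'_sum _ _ _ fP) ?normrN1 ?normr1 // -(W_sum _ _ fP).
  rewrite !scaler_sumr -big_split /=.
  apply: eq_bigr => a _; rewrite !scalerA -scalerDl -!rmorphM -rmorphD.
  by rewrite average rmorph1 scale1r.
(* Extremality identifies [Psi'] with [Phi], but its operator at [a0] is zero; dropping it
   contradicts the minimality of [r]. *)
move=> _ Psi'E.
have [|t] := kraus_drop (a := a0) PsiW'; last first.
  by move=> lt_tr; rewrite Psi'E => /rmin; rewrite leqNgt lt_tr.
by rewrite /W' /w /s divff // mulN1r subrr raddf0 sqrtC0 scale0r.
Qed.

(** This is v^* C v for the Choi matrix C, whose (k, l) block is [Phi (delta_mx k l)]. *)
Definition choi_form Phi (v : 'cV[C]_(d1 * d2)) : C :=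
  \sum_k \sum_l \sum_a \sum_b
    ((v (mxvec_index k a) 0)^* * v (mxvec_index l b) 0) * Phi (delta_mx k l) a b.

Lemma choi_formD Phi Psi a b v :
  choi_form (a *: Phi + b *: Psi) v = a * choi_form Phi v + b * choi_form Psi v.
Proof.
rewrite /choi_form; do 4!(rewrite !mulr_sumr -big_split; apply: eq_bigr => ? _).
by rewrite !lfunE /= !lfunE !mxE /= mulrDr; congr (_ + _); rewrite mulrCA.
Qed.

Lemma sandwich_delta k l (V W : 'M[C]_(d1, d2)) a b :
  sandwich (delta_mx k l) V W a b = (V k a)^* * W l b.
Proof.
rewrite mxE (bigD1 l) //= [X in _ + X]big1 ?addr0 => [|m /negPf ml].
  rewrite mxE (bigD1 k) //= [X in _ + X]big1 ?addr0 => [|m /negPf mk].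
    by rewrite !mxE !eqxx mulr1.
  by rewrite !mxE mk mulr0.
by rewrite mxE big1 ?mul0r // => n _; rewrite !mxE ml andbF mulr0.
Qed.

(** On matrix units each Kraus term factors into a conjugate pair, so the form is a sum of squares;
    its zeros are the vectors killed by every V_j. *)
Lemma choi_form_kraus Phi r (V : 'I_r -> 'M[C]_(d1, d2)) v :
  kraus_family Phi V ->
  choi_form Phi v = \sum_j `|(mxvec (V j) *m v) 0 0| ^+ 2.
Proof.
move=> PhiV; rewrite [RHS](eq_bigr (fun j => \sum_k \sum_l \sum_a \sum_b
  (((v (mxvec_index k a) 0)^* * v (mxvec_index l b) 0) *
   sandwich (delta_mx k l) (V j) (V j) a b))); last first.
  move=> j _; rewrite normCK mulrC mxvec_mulmx rmorph_sum mulr_suml.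
  apply: eq_bigr => k _; rewrite rmorph_sum mulr_sumr; apply: eq_bigr => l _.
  rewrite mulr_suml; apply: eq_bigr => a _; rewrite mulr_sumr.
  by apply: eq_bigr => b _; rewrite sandwich_delta rmorphM /=; ring.
do 4!(rewrite [RHS]exchange_big; apply: eq_bigr => ? _).
by rewrite PhiV summxE mulr_sumr.
Qed.

(* A vector annihilated by all [V_j] gives a zero of the form of [Phi], hence of
   the forms of both summands. *)
Lemma dominated_kraus_span Phi Phi1 Phi2 r s1 s2 t
    (V : 'I_r -> 'M[C]_(d1, d2)) (W : 'I_s1 -> 'M[C]_(d1, d2))
    (W2 : 'I_s2 -> 'M[C]_(d1, d2)) :
  kraus_family Phi V -> kraus_family Phi1 W -> kraus_family Phi2 W2 ->
  0 < t < 1 -> Phi = t%:C%C *: Phi1 + (1 - t)%:C%C *: Phi2 ->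
  exists P : 'M[C]_(s1, r), forall a, W a = \sum_j P a j *: V j.
Proof.
move=> PhiV Phi1W Phi2W2 /andP[t0 t1] PhiE.
pose mV : 'M[C]_(r, d1 * d2) := \matrix_j mxvec (V j).
pose mW : 'M[C]_(s1, d1 * d2) := \matrix_a mxvec (W a).
have rowV j : row j mV = mxvec (V j) by rewrite rowK.
have rowW a : row a mW = mxvec (W a) by rewrite rowK.
suff /submxP[P mWE] : (mW <= mV)%MS.
  exists P => a; apply: (can_inj mxvecK); rewrite -rowW mWE row_mul.
  rewrite mulmx_sum_row linear_sum; apply: eq_bigr => j _ /=.
  by rewrite rowV linearZ mxE.
(* Inclusion of row spaces is tested on the columns of the cokernel of [mV], each of which is a
   vector killed by all V_j. *)
rewrite submxE; apply/eqP/matrixP => a y; rewrite mxE [RHS]mxE.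
pose v := col y (cokermx mV).
have entry m (U : 'M[C]_(m, d1 * d2)) i : (U *m cokermx mV) i y = (row i U *m v) 0 0.
  by rewrite !mxE; apply: eq_bigr => k _; rewrite !mxE.
have := entry _ mW a; rewrite mxE => ->; rewrite rowW.
have sum_ge0 n (U : 'I_n -> 'M[C]_(d1, d2)) :
    0 <= \sum_j `|(mxvec (U j) *m v) 0 0| ^+ 2.
  by apply: sumr_ge0 => j _; rewrite exprn_ge0.
have : choi_form Phi v = 0.
  rewrite (choi_form_kraus _ PhiV) big1 // => j _.
  rewrite -rowV -entry mulmx_coker mxE normr0.
  by rewrite expr0n.
rewrite PhiE choi_formD (choi_form_kraus _ Phi1W) (choi_form_kraus _ Phi2W2).
have t_gt0 : 0 < t%:C%C :> C by rewrite ltcR.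
have t'_ge0 : 0 <= (1 - t)%:C%C :> C by rewrite ler0c subr_ge0 ltW.
move/eqP; rewrite paddr_eq0 ?mulr_ge0 ?(ltW t_gt0) //.
case/andP; rewrite mulf_eq0 gt_eqF //= psumr_eq0; last first.
  by move=> j _; rewrite exprn_ge0.
by move=> /allP/(_ a (mem_index_enum _)); rewrite sqrf_eq0 normr_eq0 => /eqP.
Qed.

(** * Independent Kraus families: extremality and Choi-rank *)

Section Independent.
Variables (Phi : Hom) (r : nat) (V : 'I_r -> 'M[C]_(d1, d2)).
Hypotheses (PhiV : kraus_family Phi V) (V_indep : kraus_independent V).

Lemma independent_dominated_eq Phi1 Phi2 t :
  CP_set (dual_map Phi 1%:M) (Phi 1%:M) Phi1 -> completely_positive Phi2 ->
  0 < t < 1 -> Phi = t%:C%C *: Phi1 + (1 - t)%:C%C *: Phi2 -> Phi1 = Phi.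
Proof.
move=> [[s1 [W Phi1W]] Phi1_1 Phi1'_1] [s2 [W2 Phi2W2]] t01 PhiE.
have [P WE] := dominated_kraus_span PhiV Phi1W Phi2W2 t01 PhiE.
have W_sum L f : @sesquilinear_map C _ L f ->
    \sum_a f (W a) (W a) = combination f V (P^t* *m P).
  move=> fP; have := combination_mix fP V P (const_mx 1).
  rewrite diag_const_mx mulmx1 => <-.
  by apply: eq_bigr => a _; rewrite mxE scale1r -WE.
have relP L f : @sesquilinear_map C _ L f ->
    \sum_a f (W a) (W a) = \sum_j f (V j) (V j) ->
    combination f V (-1 *: 1%:M + P^t* *m P) = 0.
  by move=> fP fE; rewrite combinationD combination1 -fE (W_sum _ _ fP) scaleN1r addNr.
have PP : P^t* *m P = 1%:M.
  (* [Phi1] has coefficient matrix P^* P over [V]. Agreement with [Phi] at the identity, for the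
     maps and their duals, makes P^* P - 1 a relation. *)
  apply/eqP; rewrite -subr_eq0 addrC -scaleN1r; apply/eqP/V_indep; split.
    by apply: relP; [exact: sandwich_sesquilinear|rewrite -Phi1W -PhiV].
  apply: relP; first exact: dual_sandwich_sesquilinear.
  by rewrite -(dual_map_kraus _ PhiV) -(dual_map_kraus _ Phi1W).
apply/lfunP => X; rewrite Phi1W PhiV.
by rewrite [LHS](W_sum _ _ (sandwich_sesquilinear d2 X)) PP combination1.
Qed.

Lemma independent_extreme :
  extreme_points (CP_set (dual_map Phi 1%:M) (Phi 1%:M)) Phi.
Proof.
split; first by split=> //; exists r, V.
move=> Psi1 Psi2 t CP1 CP2 t01 PhiE; split.
  by apply: (independent_dominated_eq CP1 _ t01 PhiE); case: CP2.
apply: (@independent_dominated_eq _ Psi1 (1 - t) CP2); first by case: CP1.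
  by move: t01; rewrite subr_gt0 ltrBlDr ltrDl andbC.
by rewrite subKr addrC.
Qed.

(** Writing [Phi] as the average of itself with itself puts [V] in the span of a minimal family. If
    that family were smaller, the V_j would be linearly dependent. *)
Lemma independent_choi_rank : choi_rank Phi = r.
Proof.
have cp : completely_positive Phi by exists r, V.
have [[W PhiW] rmin] := choi_rankP cp.
apply/eqP; rewrite eqn_leq rmin /=; last by exists V.
have half : 0 < (2^-1 : R) < 1.
  by rewrite invr_gt0 ltr0n invf_lt1 ?ltr0n // ltr1n.
have PhiE : Phi = (2^-1)%:C%C *: Phi + (1 - 2^-1)%:C%C *: Phi.
  by rewrite -scalerDl -rmorphD addrC subrK rmorph1 scale1r.
have [P VE] := dominated_kraus_span PhiW PhiV PhiV half PhiE.
rewrite leqNgt; apply/negP => lt_r.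
have : kermx P != 0.
  by rewrite -mxrank_eq0 mxrank_ker -lt0n subn_gt0 (leq_ltn_trans (rank_leq_col P)).
case/rowV0Pn => u /sub_kermxP uP u0.
have sumV : \sum_j u 0 j *: V j = 0.
  under eq_bigr => j _ do rewrite VE scaler_sumr.
  rewrite exchange_big big1 // => k _; move/rowP/(_ k): uP; rewrite !mxE => uPk.
  by under eq_bigr => j _ do rewrite scalerA; rewrite -scaler_suml uPk scale0r.
(* Pairing the dependence [u] with each V_i gives a relation all of whose rows equal [u]. *)
have rel L f : @sesquilinear_map C _ L f ->
    combination f V (\matrix_(i, j) u 0 j) = 0.
  move=> fP; rewrite /combination big1 // => i _.
  have := sesquilinear_sum fP (fun _ : 'I_1 => 1) (u 0) (fun=> V i) V.
  rewrite sumV sesquilinear0r // big_ord1 => E; rewrite [RHS]E.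
  by apply: eq_bigr => j _; rewrite mxE conjC1 mul1r.
have /matrixP u_eq0 : \matrix_(i, j) u 0 j = 0 :> 'M[C]_r.
  apply: V_indep; split; apply: rel; first exact: sandwich_sesquilinear.
  exact: dual_sandwich_sesquilinear.
by case/eqP: u0; apply/rowP => j; have := u_eq0 j j; rewrite !mxE.
Qed.

End Independent.
End Kraus.

(** * A sparse family of 16 Kraus operators *)

Section SparseSystems.
Variable F : numDomainType.

(* A list of indices [e] stands for the equation [\sum_(p <- e) c p = 0]. *)
Definition propagate (I : eqType) (known e : seq I) : seq I :=
  if [seq p <- e | p \notin known] is [:: p] then p :: known else known.

(** The known terms of an equation vanish, so when a single term is left the equation says that it
    is zero. *)
Lemma propagate_sound (I : eqType) (c : I -> F) (eqs : seq (seq I)) known :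
  (forall e, e \in eqs -> \sum_(p <- e) c p = 0) ->
  (forall p, p \in known -> c p = 0) ->
  forall p, p \in foldl (@propagate I) known eqs -> c p = 0.
Proof.
elim: eqs known => [|e eqs IH] known // ceq cknown; apply: IH => [e' e'in|].
  by apply: ceq; rewrite inE e'in orbT.
rewrite /propagate => p; have := ceq e (mem_head _ _).
rewrite (bigID (fun p => p \in known)) /= big1 ?add0r; last by move=> ? /cknown.
rewrite -big_filter; case: [seq i <- e | i \notin known] => [|q [|q' s]];
  try by move=> _ /cknown.
by rewrite big_seq1 inE => cq /predU1P[->|/cknown].
Qed.

(* Fraction-free elimination of the first column at each step. *)
Fixpoint full_rank (n : nat) (rows : seq (seq int)) : bool :=
  if n is m.+1 then
    let p := nth [::] rows (find (fun r => r`_0 != 0) rows) in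
    (p`_0 != 0) &&
    full_rank m [seq if r`_0 == 0 then behead r else
                     mkseq (fun j => p`_0 * r`_j.+1 - r`_0 * p`_j.+1) m
                | r <- rows]
  else true.

(** Each new row is a consequence of the old ones free of [x 0], so induction handles the later
    unknowns; the pivot row then gives [x 0]. *)
Lemma full_rank_sound n rows (x : nat -> F) : full_rank n rows ->
  (forall r, r \in rows -> \sum_(j < n) (r`_j)%:~R * x j = 0) ->
  forall j, (j < n)%N -> x j = 0.
Proof.
elim: n rows x => [|n IH] rows x //=.
set p := nth [::] _ _ => /andP[p0 fr] req.
(* If no row has a nonzero head, [p] is the default [[::]] with head 0, so the test on its head
   certifies a genuine pivot. *)
have pin : p \in rows.
  rewrite mem_nth // ltnNge; apply: contra p0 => /(nth_default [::]) le.
  by rewrite /p le nth_nil.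
have xS : forall j, (j < n)%N -> x j.+1 = 0.
  apply: (IH _ (fun j => x j.+1) fr) => _ /mapP[r rin ->].
  have := req r rin; rewrite big_ord_recl => req0.
  case: eqP => [r0|_].
    move: req0; rewrite r0 mul0r add0r => req0; rewrite -[RHS]req0.
    by apply: eq_bigr => j _; rewrite nth_behead.
  have := req p pin; rewrite big_ord_recl => peq0.
  under eq_bigr => j _ do rewrite nth_mkseq // intrB !intrM mulrBl -!mulrA.
  rewrite sumrB -!mulr_sumr.
  have /eqP := peq0; rewrite addrC addr_eq0 => /eqP ->.
  have /eqP := req0; rewrite addrC addr_eq0 => /eqP ->.
  by rewrite !mulrN opprK mulrCA addNr.
case=> [_|j /xS //]; have := req p pin.
rewrite big_ord_recl big1 ?addr0 => [/eqP|j _]; last by rewrite xS ?mulr0.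
by rewrite mulf_eq0 intr_eq0 (negPf p0) => /eqP.
Qed.

End SparseSystems.

(* A 12 x 12 array with 16 symbols, each filling three cells and occurring at
   most once in every row and column; 16 marks the blank cells.  It was found by
   computer search so that [symbol_indep] holds. *)
Definition square : seq (seq nat) :=
  [:: [:: 16; 16;  7; 16; 16; 16; 16;  6;  4; 15; 16; 16];
      [:: 16;  8; 16; 12; 16; 16; 16; 16; 16;  9; 13; 16];
      [::  1; 10; 16; 16; 16; 16; 16;  5; 16; 16; 16; 13];
      [:: 16; 16; 16; 16; 16; 12;  7; 16; 16;  1; 16;  6];
      [:: 16; 16; 16; 16;  8;  0; 16; 11; 16; 16;  1; 16];
      [::  2; 16; 13; 16;  7; 16; 16; 16; 16; 11; 16; 16];
      [:: 14; 16; 16; 15; 16;  5; 16; 16; 10; 16; 16; 16];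
      [:: 16;  6; 16; 16;  3; 16; 16; 16; 14; 16; 16;  9];
      [:: 16; 16; 14;  8; 16; 16; 16; 16; 16; 16;  4;  0];
      [:: 12; 16; 16; 16; 16; 16; 10; 16; 11; 16;  3; 16];
      [:: 16; 16; 16;  4;  5; 16;  9;  2; 16; 16; 16; 16];
      [:: 16;  2; 15; 16; 16;  3;  0; 16; 16; 16; 16; 16]]%N.

Definition symbol (k l : nat) : nat := nth 16%N (nth [::] square k) l.

(* The positions (i, j) for which the entry (l, m) of [U_i^T U_j] is nonzero,
   listed with multiplicity, where [U_i] is the 0-1 matrix of the cells of the
   symbol [i]; for the transposed array these are the entries of [U_i U_j^T]. *)
Definition overlaps (s : nat -> nat -> nat) (l m : nat) : seq (nat * nat) :=
  [seq p <- [seq (s k l, s k m) | k <- iota 0 12] | (p.1 < 16)%N && (p.2 < 16)%N].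

Definition overlap_system : seq (seq (nat * nat)) :=
  [seq overlaps symbol l m | l <- iota 0 12, m <- iota 0 12] ++
  [seq overlaps (fun k l => symbol l k) l m | l <- iota 0 12, m <- iota 0 12].

Definition incidence (e : seq (nat * nat)) : seq int :=
  mkseq (fun j => (count_mem (j, j) e)%:Z) 16.

Definition diagonal_rows : seq (seq int) :=
  [seq incidence (overlaps symbol l l) | l <- iota 0 12] ++
  [seq incidence (overlaps (fun k l => symbol l k) l l) | l <- iota 0 12].

Lemma big_iota_ord (V : nmodType) n (f : nat -> V) :
  \sum_(k <- iota 0 n) f k = \sum_(k < n) f k.
Proof. by rewrite -[n in iota 0 n]subn0 -/(index_iota 0 n) big_mkord. Qed.

Lemma sum_ord_pick (K : pzSemiRingType) n (a : nat) (f : nat -> K) :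
  \sum_(i < n) (a == i)%:R * f i = (a < n)%:R * f a.
Proof.
have [lt_an|le_na] := ltnP a n; last first.
  by rewrite mul0r big1 // => i _; rewrite gtn_eqF ?mul0r // (leq_trans _ le_na).
rewrite (bigD1 (Ordinal lt_an)) //= eqxx big1 ?addr0 // => i /negPf ia.
by rewrite -[a]/(val (Ordinal lt_an)) val_eqE eq_sym ia mul0r.
Qed.

(** At a diagonal entry every overlap is a pair (i, i), so only the coefficients c_ii occur and the
    equation is an integer row in them. *)
Lemma sum_incidence (F : numDomainType) s l (c : nat -> nat -> F) :
  \sum_(j < 16) ((incidence (overlaps s l l))`_j)%:~R * c j j =
  \sum_(p <- overlaps s l l) c p.1 p.2.
Proof.
under eq_bigr => j _ do rewrite nth_mkseq //.
have : all (fun p => (p.1 == p.2) && (p.1 < 16)%N) (overlaps s l l).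
  apply/allP => p; rewrite mem_filter => /andP[/andP[-> _]].
  by case/mapP => k _ ->; rewrite eqxx.
elim: (overlaps s l l) => [|[i i'] e IH] /=.
  by rewrite big_nil big1 // => j _; rewrite mul0r.
case/andP=> /andP[/eqP <- lt_i] /IH {}IH; rewrite big_cons -IH /=.
have := sum_ord_pick 16 i (fun j => c j j); rewrite lt_i mul1r => <-.
rewrite -big_split; apply: eq_bigr => j _ /=.
by rewrite -mulrDl -!pmulrn -natrD xpair_eqE andbb.
Qed.

Definition known_pairs : seq (nat * nat) :=
  foldl (@propagate _) (foldl (@propagate _) [::] overlap_system) overlap_system.

Definition off_diagonal_cover (s : seq (nat * nat)) : bool :=
  all (fun i => all (fun j => (i == j) || ((i, j) \in s)) (iota 0 16)) (iota 0 16).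

Lemma known_pairs_cover : off_diagonal_cover known_pairs.
Proof. by vm_compute. Qed.

Lemma full_rank_diagonal_rows : full_rank 16 diagonal_rows.
Proof. by vm_compute. Qed.

Lemma symbol_indep (F : numDomainType) (c : nat -> nat -> F) :
  (forall l m, (l < 12)%N -> (m < 12)%N ->
     \sum_(p <- overlaps symbol l m) c p.1 p.2 = 0) ->
  (forall l m, (l < 12)%N -> (m < 12)%N ->
     \sum_(p <- overlaps (fun k l => symbol l k) l m) c p.1 p.2 = 0) ->
  forall i j, (i < 16)%N -> (j < 16)%N -> c i j = 0.
Proof.
move=> ceq ceq' i j lt_i lt_j; have [<- {lt_j}|ij] := eqVneq i j.
  move: i lt_i; apply: (full_rank_sound (x := fun j => c j j) full_rank_diagonal_rows).
  move=> r; rewrite mem_cat => /orP[] /mapP[l]; rewrite mem_iota => lt_l ->.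
    by rewrite sum_incidence ceq.
  by rewrite sum_incidence ceq'.
have ceqs e : e \in overlap_system -> \sum_(p <- e) c p.1 p.2 = 0.
  by rewrite mem_cat => /orP[] /allpairsP[[l m] []];
    rewrite !mem_iota => lt_l lt_m ->; [exact: ceq|exact: ceq'].
have known0 p : p \in known_pairs -> c p.1 p.2 = 0.
  have nil0 q : q \in [::] -> c q.1 q.2 = 0 by [].
  pose c' q := c q.1 q.2.
  exact: (propagate_sound (c := c') ceqs (propagate_sound (c := c') ceqs nil0)).
apply: (known0 (i, j)); move: known_pairs known_pairs_cover {known0} => known.
move/allP/(_ i); rewrite mem_iota => /(_ lt_i)/allP/(_ j).
by rewrite mem_iota (negPf ij) => /(_ lt_j).
Qed.

(** * From the array of symbols to Kraus operators *)

Section SymbolMatrices.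
Variable C : numClosedFieldType.

Definition symbol_mx (j : 'I_16) : 'M[C]_12 := \matrix_(k, l) (symbol k l == j)%:R.

(** For fixed k the indicators select i = s k l and j = s k m, or nothing if either is blank; the
    bound in [overlaps] makes [inord] harmless. *)
Lemma sum_overlaps (s : nat -> nat -> nat) l m (c : 'M[C]_16) :
  \sum_i \sum_j c i j * (\sum_(k < 12) (s k l == i)%:R * (s k m == j)%:R) =
  \sum_(p <- overlaps s l m) c (inord p.1) (inord p.2).
Proof.
rewrite big_filter big_map [RHS]big_mkcond big_iota_ord /=.
under eq_bigr => i _ do (under eq_bigr => j _ do rewrite mulr_sumr;
  rewrite exchange_big).
rewrite exchange_big; apply: eq_bigr => k _ /=.
transitivity (\sum_(i < 16) (s k l == i)%:R * (\sum_(j < 16) (s k m == j)%:R *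
    c (inord i) (inord j))).
  apply: eq_bigr => i _; rewrite mulr_sumr; apply: eq_bigr => j _.
  by rewrite !inord_val mulrCA; congr (_ * _); rewrite mulrC.
under eq_bigr => i _ do
  rewrite (sum_ord_pick 16 (s k m) (fun j => c (inord i) (inord j))).
rewrite (sum_ord_pick 16 (s k l)
  (fun i => (s k m < 16)%:R * c (inord i) (inord (s k m)))).
by do 2!case: (_ < 16)%N; rewrite ?mul0r ?mul1r ?mulr0 ?mul0r.
Qed.

Lemma combination_symbol_mx c l m :
  combination (sandwich 1%:M) symbol_mx c l m =
  \sum_(p <- overlaps symbol l m) c (inord p.1) (inord p.2).
Proof.
rewrite -sum_overlaps summxE; apply: eq_bigr => i _; rewrite summxE.
apply: eq_bigr => j _; rewrite mxE /sandwich mulmx1 mxE; congr (_ * _).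
by apply: eq_bigr => k _; rewrite !mxE conjC_nat.
Qed.

(** The entry is (m, l) because [dual_sandwich] puts its second operator on the left. *)
Lemma dual_combination_symbol_mx c l m :
  combination (dual_sandwich 1%:M) symbol_mx c m l =
  \sum_(p <- overlaps (fun k l => symbol l k) l m) c (inord p.1) (inord p.2).
Proof.
rewrite -sum_overlaps summxE; apply: eq_bigr => i _; rewrite summxE.
apply: eq_bigr => j _; rewrite mxE /dual_sandwich mulmx1 mxE; congr (_ * _).
by apply: eq_bigr => k _; rewrite !mxE conjC_nat mulrC.
Qed.

Lemma symbol_mx_independent : kraus_independent symbol_mx.
Proof.
move=> c [/matrixP c1 /matrixP c2]; apply/matrixP => i j; rewrite mxE.
rewrite -(inord_val i) -(inord_val j).
apply: (symbol_indep (c := fun i j => c (inord i) (inord j))) => // l m lt_l lt_m.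
  have := c1 (Ordinal lt_l) (Ordinal lt_m).
  by rewrite combination_symbol_mx mxE.
have := c2 (Ordinal lt_m) (Ordinal lt_l).
by rewrite dual_combination_symbol_mx mxE.
Qed.

Lemma sum_overlaps1 s l m :
  \sum_(p <- overlaps s l m) (1%:M : 'M[C]_16) (inord p.1) (inord p.2) =
  (count (fun p => p.1 == p.2) (overlaps s l m))%:R.
Proof.
rewrite -sum1_count natr_sum [RHS]big_mkcond big_seq [RHS]big_seq.
apply: eq_bigr => p; rewrite mem_filter => /andP[/andP[lt1 lt2] _].
by rewrite mxE -val_eqE /= !inordK //; case: eqP.
Qed.

(** The 4 counts the filled cells of a column; off the diagonal nothing survives, as no symbol
    repeats within a row. *)
Lemma sum_symbol_mx :
  \sum_j sandwich 1%:M (symbol_mx j) (symbol_mx j) = 4%:R%:M.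
Proof.
have cnt : all (fun l => all (fun m =>
    count (fun p => p.1 == p.2) (overlaps symbol l m) == ((l == m) * 4)%N)
  (iota 0 12)) (iota 0 12) by vm_compute.
rewrite -combination1; apply/matrixP => l m.
rewrite combination_symbol_mx sum_overlaps1 mxE -val_eqE /=.
move/allP/(_ l): cnt; rewrite mem_iota => /(_ (ltn_ord l))/allP/(_ m).
by rewrite mem_iota => /(_ (ltn_ord m))/eqP ->; case: eqP.
Qed.

Lemma dual_sum_symbol_mx :
  \sum_j dual_sandwich 1%:M (symbol_mx j) (symbol_mx j) = 4%:R%:M.
Proof.
have cnt : all (fun l => all (fun m =>
    count (fun p => p.1 == p.2) (overlaps (fun k l => symbol l k) l m)
      == ((l == m) * 4)%N)
  (iota 0 12)) (iota 0 12) by vm_compute.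
rewrite -combination1; apply/matrixP => m l.
rewrite dual_combination_symbol_mx sum_overlaps1 mxE -val_eqE eq_sym /=.
move/allP/(_ l): cnt; rewrite mem_iota => /(_ (ltn_ord l))/allP/(_ m).
by rewrite mem_iota => /(_ (ltn_ord m))/eqP ->; case: eqP.
Qed.

End SymbolMatrices.

(** * The value of the supremum for d1 = d2 = 12 *)

Lemma symbol_map_extreme (R : realType) (A := 12%:R^-1 *: (1%:M : 'M[R[i]]_12)) :
  exists2 Phi, extreme_points (CP_set A A) Phi & choi_rank Phi = 16%N.
Proof.
(* The unscaled Kraus sums are 4 I, and 4 / 48 = 1 / 12. *)
pose a : R[i] := sqrtC 48%:R^-1.
have a0 : a != 0 by rewrite sqrtC_eq0 invr_eq0 pnatr_eq0.
pose V j := a *: symbol_mx R[i] j.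
have V_indep : kraus_independent V.
  exact/kraus_independentZ/symbol_mx_independent.
have V_sum f : sesquilinear_map f ->
    \sum_j f (symbol_mx _ j) (symbol_mx _ j) = 4%:R%:M -> \sum_j f (V j) (V j) = A.
  move=> fP fE; under eq_bigr => j _ do rewrite sesquilinear_sqrtC ?invr_ge0 ?ler0n //.
  rewrite -scaler_sumr fE /A -[4%:R%:M]scalemx1 scalerA; congr (_ *: _).
  by field.
have [Phi PhiV] := kraus_map_exists V.
have := independent_extreme PhiV V_indep.
rewrite PhiV (dual_map_kraus _ PhiV) !V_sum.
- by exists Phi => //; exact: (independent_choi_rank PhiV).
- exact: sandwich_sesquilinear.
- exact: sum_symbol_mx.
- exact: dual_sandwich_sesquilinear.
- exact: dual_sum_symbol_mx.
Qed.

Theorem corollary4p9 (R : realType) :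
  MR (12%:R^-1 *: (1%:M : 'M[R[i]]_12)) (12%:R^-1 *: (1%:M : 'M[R[i]]_12))
    = (16%:R : R)%:E
  /\ Num.floor (Num.sqrt (12%:R ^+ 2 + 12%:R ^+ 2 - 1 : R)) = 16%:Z.
Proof.
split; last first.
  (* The floor is 16 since 16^2 = 256 <= 287 < 289 = 17^2. *)
  rewrite (_ : _ - 1 = 287%:R); last by ring.
  have sq_ge0 := sqrtr_ge0 (287%:R : R).
  have sqE : Num.sqrt (287%:R : R) ^+ 2 = 287%:R by rewrite sqr_sqrtr ?ler0n.
  apply: floor_def; apply/andP; split.
    by rewrite -ler_sqr ?nnegrE ?ler0n // sqE -natrX ler_nat.
  by rewrite -ltr_sqr ?nnegrE ?ler0n // sqE -natrX ltr_nat.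
apply/eqP; rewrite eq_le; apply/andP; split.
  apply: ge_ereal_sup => _ [Phi Phi_ext <-]; rewrite lee_fin ler_nat.
  have lt_rk := extreme_choi_rank (erefl : (0 < 12)%N) Phi_ext.
  (* A rank of at least 17 would give a square of at least 289, above 12^2 + 12^2 = 288. *)
  rewrite leqNgt; apply: contraL lt_rk => lt_16; rewrite -leqNgt.
  by apply: (@leq_trans (17 ^ 2)); rewrite ?leq_exp2r.
have [Phi Phi_ext rk] := symbol_map_extreme R.
by apply: ereal_sup_ubound; exists Phi => //; rewrite rk.
Qed.
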